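(* Let $p_1\in\mathbb{R}$. Consider the following properties of a pair of functions $c_1,c_2:\mathbb{R}\to\mathbb{R}$. \begin{enumerate} \item The pair $(c_1,c_2)$ is admissible with $Z_{\rm F}=\{p_1\}$, and the images of $c_1$ and $c_2$ are both $\{x\in\mathbb{R}\mid x>p_1\}$. \item The set $S(c_1)$ is empty and the set $S(c_2)\subset\mathbb{R}$ is unbounded. \item Both $c_1(x)$ and $c_2(x)$ converge to $p_1$ as $x$ diverges to $-\infty$. \item Both $c_1(x)$ and $c_2(x)$ diverge to $+\infty$ as $x$ diverges to $+\infty$. \item The sets $S(c_1)\subset\mathbb{R}$ and $S(c_2)\subset\mathbb{R}$ are unbounded. \item The sets $S(c_1)\subset\mathbb{R}$ and $S(c_2)\subset\mathbb{R}$ are bounded below and unbounded above. \end{enumerate} Then there exist two globally similar real analytic functions $c_1,c_2$ with properties (1), (2), (3), (4). There also exist two globally similar real analytic functions $c_1,c_2$ with properties (1), (3), (4), (5). There also exist two globally similar real analytic functions $c_1,c_2$ with properties (1), (3), (4), (6).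
   Context: For a differentiable function $c$, $S(c)$ denotes its set of critical points. An $\mathbb{R}$-$\mathbb{R}$ TS function is a smooth function $c:\mathbb{R}\to\mathbb{R}$ whose critical set $S(c)$ is a disjoint union of finitely many (possibly none) or countably many sets each of which is a one-point set or a copy of $D^1=[-1,1]$, $\{t\ge0\}$, or $\mathbb{R}$. Admissibility: put $D_{c_1,c_2}:=\{(x_1,x_2)\in\mathbb{R}^2\mid c_1(x_2)<x_1<c_2(x_2)\}$ with closure $\overline{D_{c_1,c_2}}$ in $\mathbb{R}^2$, and $\pi_{2,1}(x_1,x_2)=x_1$. A contour of a function is a connected component of a level set. For a discrete closed subset $Z_{\rm F}\subset\mathbb{R}$, the pair $(c_1,c_2)$ is admissible with $Z_{\rm F}$ if: $c_1,c_2$ are $\mathbb{R}$-$\mathbb{R}$ TS functions with $c_1(x)<c_2(x)$ for all $x$; $(c_1(S(c_1))\cup c_2(S(c_2)))\cap(\mathbb{R}-Z_{\rm F})$ is discrete and closed in $\mathbb{R}-Z_{\rm F}$; and for each $p\in Z_{\rm F}$ and each contour $C_p$ of $\pi_{2,1}|_{\overline{D_{c_1,c_2}}}$ in the level set $\pi_{2,1}^{-1}(p)\cap\overline{D_{c_1,c_2}}$ there is a connected neighborhood $K(C_p)$ of $C_p$ in $\overline{D_{c_1,c_2}}$ which is a disjoint union of contours of $\pi_{2,1}|_{\overline{D_{c_1,c_2}}}$, is closed in $\overline{D_{c_1,c_2}}$, and is such that $K(C_p)-C_p$ contains no point $(c_i(x),x)$ with $i\in\{1,2\}$, $x\in S(c_i)$.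 Global similarity: two subsets of $\mathbb{R}^k$ are congruent if one is mapped onto the other by a composition of finitely many rotations, reflections and parallel translations. Graphs $\{(c_{0,1}(x),x)\mid x\in\mathbb{R}\}$ and $\{(c_{0,2}(x),x)\mid x\in\mathbb{R}\}$ of functions $c_{0,i}:\mathbb{R}\to\mathbb{R}$ (and the functions themselves) are globally similar if they are congruent, or if they are respectively congruent to graphs $\{(c_{1,1}(x),x)\mid x\in\mathbb{R}\}$ and $\{(c_{1,2}(x),x)\mid x\in\mathbb{R}\}$ of functions $c_{1,i}:\mathbb{R}\to\mathbb{R}$ with $c_{1,2}(x)=c_{1,1}(x)+p(x)$ for some smooth bounded function $p:\mathbb{R}\to\mathbb{R}$. *)

(* Defs.v *)
(* The plane is R * R, with R : realType and its product topology. *)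
From HB Require Import structures.
From mathcomp Require Import all_boot all_order all_algebra.
From mathcomp Require Import all_classical all_reals all_analysis.

Set Implicit Arguments.
Unset Strict Implicit.
Unset Printing Implicit Defensive.

Import Order.TTheory GRing.Theory Num.Theory.
Import numFieldNormedType.Exports.

Local Open Scope classical_set_scope.
Local Open Scope ring_scope.

Section subsets.
Context {T : topologicalType}.
Implicit Types A C E : set T.

Definition discrete_subset A : Prop := A `<=` isolated A.

(* Only used for A `<=` E: the topology of [subspace E] is discrete off E. *)
Definition closed_in E A : Prop := closed (A : set (subspace E)).

Definition neighborhood_in E C A : Prop :=
  set_nbhs (C : set (subspace E)) (A : set (subspace E)).

Definition contour_at {U : Type} (E : set T) (f : T -> U) (q : U) C :
    Prop :=
  exists2 z, (E `&` f @^-1` [set q]) z &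
    C = connected_component (E `&` f @^-1` [set q]) z.

Definition contour {U : Type} (E : set T) (f : T -> U) C : Prop :=
  exists q, contour_at E f q C.

End subsets.

(* F is a family of pairwise disjoint sets satisfying P, with union A. *)
Definition disjoint_union_of {T : Type} (P : set T -> Prop) (F : set (set T))
    (A : set T) : Prop :=
  [/\ trivIset F id, forall B, F B -> P B & A = \bigcup_(B in F) B].

Section functions.
Context {R : realType}.
Implicit Types (c : R -> R) (A B S : set R).

Definition homeomorphic A B : Prop :=
  exists f g : R -> R,
    [/\ {within A, continuous f}, {within B, continuous g},
        f @` A = B, g @` B = A &
        {in A, cancel f g} /\ {in B, cancel g f}].

Definition smooth c : Prop := forall n x, derivable (c^`(n))%classic x 1.

Definition real_analytic c : Prop :=
  forall x0, exists a : R^nat, exists2 r : R, 0 < r &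
    forall x, `|x - x0| < r -> pseries a (x - x0) @ \oo --> c x.

Definition crit c : set R := [set x : R | is_derive x 1 c 0].

Definition TS_piece A : Prop :=
  [\/ exists x, A = [set x], homeomorphic A `[-1, 1],
      homeomorphic A `[0, +oo[ | homeomorphic A setT].

(* [countable] includes the finite and the empty families. *)
Definition TS_function c : Prop :=
  smooth c /\
  exists2 F : set (set R), countable F & disjoint_union_of TS_piece F (crit c).

Definition region (c1 c2 : R -> R) : set (R * R) :=
  [set x | c1 x.2 < x.1 < c2 x.2].

Definition crit_points_on_graph c : set (R * R) :=
  [set (c x, x) | x in crit c].

Definition admissible (Z : set R) (c1 c2 : R -> R) : Prop :=
  let E := closure (region c1 c2) in
  let V := (c1 @` crit c1 `|` c2 @` crit c2) `&` ~` Z in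
  [/\ closed Z /\ discrete_subset Z,
      TS_function c1 /\ TS_function c2,
      forall x, c1 x < c2 x,
      discrete_subset V /\ closed_in (~` Z) V &
      forall p C, Z p -> contour_at E fst p C ->
        exists K : set (R * R),
          [/\ connected K, neighborhood_in E C K,
              exists F, disjoint_union_of (contour E fst) F K,
              closed_in E K &
              (K `\` C) `&` (crit_points_on_graph c1 `|` crit_points_on_graph c2)
                = set0]].

(* Motions of the plane: rotations about an arbitrary center, reflections in
   the line through a orthogonal to n, and parallel translations. *)

Definition rotation (a : R * R) (t : R) (x : R * R) : R * R :=
  (a.1 + (cos t * (x.1 - a.1) - sin t * (x.2 - a.2)),
   a.2 + (sin t * (x.1 - a.1) + cos t * (x.2 - a.2))).

Definition reflection (a n x : R * R) : R * R :=
  let k := 2 * ((x.1 - a.1) * n.1 + (x.2 - a.2) * n.2) / (n.1 ^+ 2 + n.2 ^+ 2) in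
  (x.1 - k * n.1, x.2 - k * n.2).

Definition translation (v x : R * R) : R * R := (x.1 + v.1, x.2 + v.2).

Inductive motion : (R * R -> R * R) -> Prop :=
| motion_rotation a t : motion (rotation a t)
| motion_reflection a n : n <> (0, 0) -> motion (reflection a n)
| motion_translation v : motion (translation v)
| motion_comp f g : motion f -> motion g -> motion (f \o g).

Definition congruent (A B : set (R * R)) : Prop :=
  exists2 f, motion f & f @` A = B.

Definition graph c : set (R * R) := [set (c x, x) | x in setT].

Definition globally_similar (c01 c02 : R -> R) : Prop :=
  congruent (graph c01) (graph c02) \/
  exists c11 c12 p : R -> R,
    [/\ congruent (graph c01) (graph c11), congruent (graph c02) (graph c12),
        smooth p, bounded_set (range p) & forall x, c12 x = c11 x + p x].

Definition admissible_onto_ray (p1 : R) (c1 c2 : R -> R) : Prop :=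
  [/\ admissible [set p1] c1 c2,
      range c1 = [set x | p1 < x] & range c2 = [set x | p1 < x]].

Definition cvg_at_ninfty (p1 : R) (c1 c2 : R -> R) : Prop :=
  c1 x @[x --> -oo] --> p1 /\ c2 x @[x --> -oo] --> p1.

Definition diverge_at_pinfty (c1 c2 : R -> R) : Prop :=
  c1 x @[x --> +oo] --> +oo /\ c2 x @[x --> +oo] --> +oo.

Definition crit_empty_unbounded (c1 c2 : R -> R) : Prop :=
  crit c1 = set0 /\ ~ bounded_set (crit c2).

Definition crit_unbounded (c1 c2 : R -> R) : Prop :=
  ~ bounded_set (crit c1) /\ ~ bounded_set (crit c2).

Definition lbounded_not_ubounded S : Prop := has_lbound S /\ ~ has_ubound S.

Definition crit_lbounded_not_ubounded (c1 c2 : R -> R) : Prop :=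
  lbounded_not_ubounded (crit c1) /\ lbounded_not_ubounded (crit c2).

End functions.

(* Main.v *)
(* With u = exp x, the function p1 + u + sin u is increasing with values in
   (p1, +oo), and it is critical exactly where u = (2k+1) pi, with values
   p1 + (2k+1) pi there.  Its critical set is thus bounded below and unbounded
   above, and its critical values are 2 pi-separated.  Together with its
   translate (x replaced by x - 1) it settles the last two parts; for the first,
   p1 + exp (x - 1) has no critical point, lies below it, and is congruent to
   p1 + exp x, from which it differs by the bounded function sin (exp x).
   The closed region contains no point over p1, so that the condition on the
   contours over p1 is vacuous. *)
Require Import Defs.
From mathcomp Require Import all_boot all_order all_algebra.
From mathcomp Require Import all_classical all_reals all_analysis.
From mathcomp Require Import ring lra.

Set Implicit Arguments.
Unset Strict Implicit.
Unset Printing Implicit Defensive.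

Import Order.TTheory GRing.Theory Num.Theory.
Import numFieldNormedType.Exports.

Local Open Scope classical_set_scope.
Local Open Scope ring_scope.

(** * Real analyticity from factorial bounds on the derivatives *)

Section analytic.
Context {R : realType}.
Implicit Types (f g : R -> R) (F G : nat -> R -> R).

Definition derivative_tower F : Prop :=
  forall n (x : R), is_derive x 1 (F n) (F n.+1 x).

(** These are Cauchy's estimates, uniform near each point. They characterize analyticity through the
    growth of derivatives and so avoid manipulating power series. *)
Definition factorial_bound F : Prop :=
  forall x0, exists C M : R, exists2 r : R, 0 < r &
    [/\ 0 <= C, 0 < M & forall n x, `|x - x0| < r ->
      `|F n x| <= C * (n`!%:R * M ^+ n)].

(** Carrying the derivatives as an explicit sequence gives smoothness and analyticity at once, and
    is stable under sums and shifts. *)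
Definition bounded_tower f : Prop :=
  exists F, [/\ F 0%N = f, derivative_tower F & factorial_bound F].

Lemma derive1n_tower F n : derivative_tower F -> (F 0%N)^`(n)%classic = F n.
Proof.
move=> dF; elim: n => // n IHn; rewrite derive1nS IHn.
by apply/funext => x; rewrite derive1E (@derive_val _ _ _ _ _ _ _ (dF n x)).
Qed.

Lemma smooth_bounded_tower f : bounded_tower f -> smooth f.
Proof.
move=> [F [<- dF _]] n x; rewrite derive1n_tower//.
exact: (@ex_derive _ _ _ _ _ _ _ (dF n x)).
Qed.

(* Taylor polynomial at t evaluated at x; its derivative in t telescopes to a
   single term, whence Cauchy's form of the remainder. *)
Definition taylor_shift F (x : R) (n : nat) (t : R) : R :=
  \sum_(k < n) F k t * ((x - t) ^+ k / k`!%:R).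

Lemma is_derive_taylor_shift F x n (t : R) : derivative_tower F ->
  is_derive t 1 (taylor_shift F x n.+1) (F n.+1 t * ((x - t) ^+ n / n`!%:R)).
Proof.
move=> dF; elim: n => [|n IHn].
  have -> : taylor_shift F x 1 = F 0%N.
    apply/funext => u.
    by rewrite /taylor_shift big_ord1 expr0 fact0 divr1 mulr1.
  by rewrite expr0 fact0 divr1 mulr1; exact: dF.
have -> : taylor_shift F x n.+2 = taylor_shift F x n.+1 \+
    (F n.+1 \* (n.+1`!%:R^-1 *: (cst x - id) ^+ n.+1)).
  apply/funext => u; rewrite /taylor_shift big_ord_recr /=; congr (_ + _ * _).
  by rewrite /= mulrC fctE.
have := dF n.+1 t => dFt.
apply: is_derive_eq.
rewrite /= !fctE /GRing.scale /= factS natrM.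
have n0 : n`!%:R != 0 :> R by rewrite pnatr_eq0 -lt0n fact_gt0.
have Sn0 : n.+1%:R != 0 :> R by rewrite pnatr_eq0.
rewrite !exprS.
by field; rewrite n0 nat1r.
Qed.

Lemma taylor_shift_self F x n : taylor_shift F x n.+1 x = F 0%N x.
Proof.
rewrite /taylor_shift big_ord_recl /= subrr expr0 fact0 divr1 mulr1.
by rewrite big1 ?addr0// => i _; rewrite expr0n /= mul0r mulr0.
Qed.

(** The two distance conditions together confine [t] to the segment between [x0] and [x], whichever
    of them is larger. *)
Lemma mean_value_bound (f df : R -> R) (x0 x K : R) :
  (forall t : R, is_derive t 1 f (df t)) ->
  (forall t, `|t - x0| <= `|x - x0| -> `|x - t| <= `|x - x0| -> `|df t| <= K) ->
  `|f x - f x0| <= K * `|x - x0|.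
Proof.
move=> dfP dfK.
have cf a b : {within `[a, b], continuous f}.
  apply: continuous_subspaceT => t.
  by apply/differentiable_continuous/derivable1_diffP; have := dfP t.
have [xx0|/ltW x0x] := leP x x0.
  have [c /itvP cI E] := MVT_segment xx0 (fun t _ => dfP t) (cf _ _).
  rewrite distrC E normrM (distrC x0) ler_wpM2r// dfK//.
    by rewrite !ler0_norm ?subr_le0 ?cI// lerN2 lerB ?cI.
  by rewrite !ler0_norm ?subr_le0 ?cI// lerN2 lerB ?cI.
have [c /itvP cI E] := MVT_segment x0x (fun t _ => dfP t) (cf _ _).
rewrite E normrM ler_wpM2r// dfK//.
  by rewrite !ger0_norm ?subr_ge0 ?cI// lerB ?cI.
by rewrite !ger0_norm ?subr_ge0 ?cI// lerB ?cI.
Qed.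

Lemma real_analytic_bounded_tower f : bounded_tower f -> real_analytic f.
Proof.
move=> [F [<- dF bF]] x0; have [C [M [r r0 [C0 M0 FCM]]]] := bF x0.
(* The second bound on the radius gives [M * h <= 1 / 4], which beats the factor [n + 1] left in the
   remainder. *)
exists (fun n => F n x0 / n`!%:R), (Num.min r (4 * M)^-1).
  by rewrite lt_min r0 invr_gt0 mulr_gt0.
move=> x; rewrite lt_min => /andP[xr xM].
set h := `|x - x0| in xr xM.
have h0 : 0 <= h by exact: normr_ge0.
have Mh : 0 <= M * h <= 1 / 4.
  rewrite mulr_ge0 ?(ltW M0)//= -ler_pdivlMl//.
  by rewrite (le_trans (ltW xM))// invfM mul1r mulrC.
have main n : `|F 0%N x - taylor_shift F x n.+1 x0| <= C * M * h * (1 / 2) ^+ n.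
  rewrite -[F 0%N x](taylor_shift_self F x n).
  have bnd t : `|t - x0| <= h -> `|x - t| <= h ->
      `|F n.+1 t * ((x - t) ^+ n / n`!%:R)| <= C * M * (1 / 2) ^+ n.
    move=> th xth; rewrite normrM.
    have nf : 0 < n`!%:R :> R by rewrite ltr0n fact_gt0.
    rewrite normrM normfV normrX (ger0_norm (ltW nf)).
    have e1 : `|F n.+1 t| <= C * (n.+1`!%:R * M ^+ n.+1).
      by apply: FCM; exact: le_lt_trans th xr.
    have e2 : `|x - t| ^+ n <= h ^+ n by rewrite lerXn2r.
    have e3 : `|x - t| ^+ n / n`!%:R <= h ^+ n / n`!%:R.
      by rewrite ler_wpM2r// invr_ge0 ltW.
    apply: (le_trans (ler_pM _ _ e1 e3)) => //.
    have -> : C * (n.+1`!%:R * M ^+ n.+1) * (h ^+ n / n`!%:R) =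
        C * M * (n.+1%:R * (M * h) ^+ n).
      by rewrite factS natrM exprS exprMn; field; exact: lt0r_neq0.
    rewrite ler_wpM2l ?mulr_ge0 ?(ltW M0)//.
    (* The factor [2 ^+ n] absorbs [n + 1], and [(1 / 4) ^+ n] dominates [(M * h) ^+ n]. *)
    have -> : (1 / 2) ^+ n = 2 ^+ n * (1 / 4) ^+ n :> R.
      by rewrite -exprMn; congr (_ ^+ _); field.
    rewrite ler_pM ?exprn_ge0//; first by case/andP: Mh.
      by rewrite -natrX ler_nat ltn_expl.
    by rewrite lerXn2r// ?nnegrE; case/andP: Mh.
  rewrite -mulrA (mulrC h) mulrA.
  exact: mean_value_bound (fun t => is_derive_taylor_shift x n t dF) bnd.
(* The estimate [main] concerns Taylor polynomials with [n + 1] terms, hence the index shift. *)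
rewrite -cvg_shiftS /=.
have -> : (fun n => pseries (fun n => F n x0 / n`!%:R) (x - x0) n.+1) =
    (fun n => taylor_shift F x n.+1 x0).
  apply/funext => n; rewrite /pseries /series /taylor_shift /= big_mkord.
  by apply: eq_bigr => i _; rewrite mulrAC mulrA.
apply/subr_cvg0.
apply/norm_cvg0P.
apply: (@squeeze_cvgr _ _ _ _ (fun=> 0) (geometric (C * M * h) (1/2))).
- by near=> n; rewrite normr_ge0 /= distrC; exact: main.
- exact: cvg_cst.
- by apply: cvg_geometric; rewrite ger0_norm; lra.
Unshelve. all: by end_near.
Qed.

Lemma bounded_tower_cst (a : R) : bounded_tower (cst a).
Proof.
exists (fun n => if n is 0%N then cst a else cst 0); split=> [//|[|n] x|x0].
- exact: is_derive_cst.
- exact: is_derive_cst.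
- exists `|a|, 1, 1 => //; split=> // n x _; rewrite expr1n mulr1.
  by case: n => [|n] /=; rewrite ?fact0 ?mulr1// normr0 mulr_ge0.
Qed.

Lemma bounded_towerD f g :
  bounded_tower f -> bounded_tower g -> bounded_tower (f \+ g).
Proof.
move=> [F [<- dF bF]] [G [<- dG bG]].
exists (fun n => F n \+ G n); split=> [//|n x|x0].
  by have := dF n x; have := dG n x => *; exact: is_deriveD.
have [C [M [r r0 [C0 M0 FCM]]]] := bF x0.
have [D [N [s s0 [D0 N0 GDN]]]] := bG x0.
exists (C + D), (M + N), (Num.min r s); first by rewrite lt_min r0.
split=> [||n x]; [exact: addr_ge0|exact: addr_gt0|].
rewrite lt_min => /andP[xr xs]; rewrite mulrDl.
apply: (le_trans (ler_normD _ _)); apply: lerD.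
  apply: (le_trans (FCM n x xr)).
  rewrite !ler_wpM2l// lerXn2r ?nnegrE ?addr_ge0 ?(ltW M0) ?(ltW N0)//.
  by rewrite lerDl ltW.
apply: (le_trans (GDN n x xs)).
rewrite !ler_wpM2l// lerXn2r ?nnegrE ?addr_ge0 ?(ltW M0) ?(ltW N0)//.
by rewrite lerDr ltW.
Qed.

Lemma bounded_tower_shift f (s : R) :
  bounded_tower f -> bounded_tower (fun x => f (x - s)).
Proof.
move=> [F [<- dF bF]]; exists (fun n x => F n (x - s)); split=> [//|n x|x0].
  have := dF n (x - s) => dFs.
  have ds : is_derive x 1 (id \- cst s : R -> R) 1.
    by apply: is_derive_eq; rewrite subr0.
  by rewrite -[F n.+1 _]mulr1; exact: (@is_derive1_comp _ (F n) (id \- cst s)).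
have [C [M [r r0 [C0 M0 FCM]]]] := bF (x0 - s).
exists C, M, r => //; split=> // n x xr; apply: FCM.
by rewrite opprB addrA subrK.
Qed.

Lemma bounded_tower_expR : bounded_tower (@expR R).
Proof.
exists (fun=> expR); split=> [//|n x|x0]; first exact: is_derive_expR.
exists (expR (x0 + 1)), 1, 1 => //; split=> // n x.
rewrite ltr_distl => /andP[_ x1]; rewrite expr1n mulr1 ger0_norm ?expR_ge0//.
rewrite -[leLHS]mulr1 ler_pM ?expR_ge0// ?ler_expR ?(ltW x1)//.
by rewrite ler1n fact_gt0.
Qed.

(* If T k' = k T k + T (k+1), then the n-th derivative of T k is a combination
   of T k, ..., T (k+n), with Stirling numbers of the second kind when k = 0. *)
Fixpoint stirling_tower (T : nat -> R -> R) (n k : nat) : R -> R :=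
  if n is n'.+1 then
    fun x => k%:R * stirling_tower T n' k x + stirling_tower T n' k.+1 x
  else T k.

Lemma is_derive_stirling_tower (T : nat -> R -> R) n k (x : R) :
  (forall k (x : R), is_derive x 1 (T k) (k%:R * T k x + T k.+1 x)) ->
  is_derive x 1 (stirling_tower T n k) (stirling_tower T n.+1 k x).
Proof.
move=> dT; elim: n k => [|n IHn] k; first exact: dT.
have := IHn k; have := IHn k.+1 => d1 d2.
exact: (@is_deriveD _ _ _ (k%:R *: stirling_tower T n k)).
Qed.

(** Induction on [n] for all [k]: in the recurrence the first term costs a factor [k <= n + k + 1]
    and the second a factor [L], which together produce one more [1 + L]. The case [k = 0] is the
    factorial bound. *)
Lemma stirling_tower_bound (T : nat -> R -> R) (L : R) (x : R) n k :
  0 <= L -> (forall k, `|T k x| <= L ^+ k) ->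
  `|stirling_tower T n k x| * k`!%:R <=
    L ^+ k * ((n + k)`!%:R * (1 + L) ^+ n).
Proof.
move=> L0 TL; elim: n k => [|n IHn] k.
  by rewrite add0n expr0 mulr1 ler_wpM2r.
rewrite /=.
have kf : 0 < k`!%:R :> R by rewrite ltr0n fact_gt0.
have e1 := IHn k; have e2 := IHn k.+1.
have nD : `|k%:R * stirling_tower T n k x + stirling_tower T n k.+1 x| <=
    k%:R * `|stirling_tower T n k x| + `|stirling_tower T n k.+1 x|.
  by apply: (le_trans (ler_normD _ _)); rewrite normrM normr_nat.
apply: (le_trans (ler_wpM2r (ltW kf) nD)).
set Q := (n + k)`!%:R * (1 + L) ^+ n in e1.
have Q0 : 0 <= Q by rewrite mulr_ge0 ?exprn_ge0 ?addr_ge0.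
have e2' : `|stirling_tower T n k.+1 x| * k`!%:R <=
    L ^+ k.+1 * ((n + k).+1%:R * Q).
  apply: le_trans (_ : `|stirling_tower T n k.+1 x| * k.+1`!%:R <= _).
    by rewrite ler_wpM2l// ler_nat factS leq_pmull.
  by apply: (le_trans e2); rewrite addnS factS natrM /Q !mulrA.
rewrite mulrDl -mulrA.
apply: le_trans (lerD (ler_wpM2l _ e1) e2') _ => //.
have -> : L ^+ k * ((n.+1 + k)`!%:R * (1 + L) ^+ n.+1) =
    L ^+ k * ((n + k).+1%:R * Q) + L ^+ k.+1 * ((n + k).+1%:R * Q).
  by rewrite /Q addSn factS natrM !exprS; ring.
rewrite lerD2r mulrCA ler_wpM2l ?exprn_ge0// ler_wpM2r// ler_nat.
by rewrite (leq_trans (leq_addl n k)).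
Qed.

Lemma bounded_tower_sin_expR : bounded_tower (fun x : R => sin (expR x)).
Proof.
(* The shift by [k] quarter turns encodes the [k]-th derivative of sine, here taken at [expR x]; the
   chain rule supplies the powers of [expR x]. *)
pose T k (x : R) : R := expR (k%:R * x) * sin (expR x + k%:R * (pi / 2)).
have dT k (x : R) : is_derive x 1 (T k) (k%:R * T k x + T k.+1 x).
  have d1 : is_derive x 1 (k%:R *: id : R -> R) k%:R.
    by apply: is_derive_eq; rewrite /GRing.scale /= mulr1.
  have d2 : is_derive x 1 (expR + cst (k%:R * (pi / 2)) : R -> R) (expR x).
    by apply: is_derive_eq; rewrite addr0.
  have d3 := @is_derive1_comp _ expR _ x _ _ (is_derive_expR _) d1.
  have d4 := @is_derive1_comp _ sin _ x _ _ (is_derive_sin _) d2.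
  have -> : T k = (expR \o (k%:R *: id)) \*
     (sin \o (expR + cst (k%:R * (pi / 2)) : R -> R)) by [].
  apply: is_derive_eq; rewrite /= /GRing.scale /= /T fctE.
  rewrite -(natr1 k) (mulrDl _ _ (pi / 2)) (mulrDl _ _ x) !mul1r expRD addrA.
  by rewrite sinDpihalf; ring.
exists (fun n => stirling_tower T n 0); split=> [|n x|x0].
- by apply/funext => x; rewrite /= /T !mul0r expR0 addr0 mul1r.
- exact: is_derive_stirling_tower.
(* Within distance 1 of [x0], [L = expR (x0 + 1)] bounds [expR x], so [T k] is at most [L ^+ k] in
   absolute value. *)
- exists 1, (1 + expR (x0 + 1)), 1 => //; split=> // n x.
  rewrite ltr_distl => /andP[_ x1].
  have := @stirling_tower_bound T (expR (x0 + 1)) x n 0 (expR_ge0 _).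
  rewrite fact0 mulr1 expr0 addn0; apply => k.
  rewrite /T normrM (ger0_norm (expR_ge0 _)) mulrC expRM_natl.
  rewrite -[leRHS]mul1r ler_pM ?exprn_ge0 ?expR_ge0 ?sin_max//.
  by rewrite lerXn2r ?nnegrE ?expR_ge0// ler_expR ltW.
Qed.
End analytic.

(** * Criteria for TS functions, admissibility and congruence *)

Section plane_curves.
Context {R : realType}.
Implicit Types (c d : R -> R) (A : set R).

Lemma continuous_smooth c : smooth c -> continuous c.
Proof.
by move=> /(_ 0%N) dc x; exact/differentiable_continuous/derivable1_diffP/dc.
Qed.

(** The critical set is cut into its points, so that only one-point pieces occur. *)
Lemma TS_function_countable c : smooth c -> countable (crit c) -> TS_function c.
Proof.
move=> sc cc; split=> //; exists [set [set x] | x in crit c].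
  exact: card_le_trans (card_image_le _ _) cc.
split.
- by move=> _ _ [x _ <-] [y _ <-] [z [-> ->]].
- by move=> _ [x _ <-]; constructor 1; exists x.
- apply/seteqP; split=> x; last by move=> [_ [y cy <-] ->].
  by move=> cx; exists [set x] => //; exists x.
Qed.

Lemma separated_discrete_closed A (e : R) : 0 < e ->
  (forall x y, A x -> A y -> `|x - y| < e -> x = y) ->
  discrete_subset A /\ closed A.
Proof.
move=> e0 Ae; split=> x.
  move=> Ax; split; first exact: mem_set.
  exists (ball x e); first exact: nbhsx_ballx.
  apply/seteqP; split=> y; first by move=> [xy Ay]; rewrite (Ae x y).
  by move=> ->; split=> //; exact: ballxx.
move=> clA.
have [y [Ay xy]] := clA _ (nbhsx_ballx x (e / 2) (divr_gt0 e0 (ltr0Sn _ _))).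
have [->//|yx] := eqVneq x y.
have d0 : 0 < `|x - y| by rewrite normr_gt0 subr_eq0.
(* A point [z] of [A] strictly nearer to [x] than [y] is still within [e] of [y], so it equals [y],
   which is absurd. *)
have [z [Az xz]] := clA _ (nbhsx_ballx x `|x - y| d0).
rewrite -ball_normE /= in xy xz.
have yz : y = z.
  apply: Ae => //; rewrite -(subrKA x) (le_lt_trans (ler_normD _ _))//.
  by rewrite (splitr e) ltrD//; [rewrite distrC|exact: lt_trans xz xy].
by rewrite yz ltxx in xz.
Qed.

Lemma admissible_above (p : R) c1 c2 (e : R) :
  TS_function c1 -> TS_function c2 ->
  (forall x, p < c1 x) -> (forall x, c1 x < c2 x) ->
  0 < e ->
  (forall v w, (c1 @` crit c1 `|` c2 @` crit c2) v ->
    (c1 @` crit c1 `|` c2 @` crit c2) w -> `|v - w| < e -> v = w) ->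
  admissible [set p] c1 c2.
Proof.
move=> TS1 TS2 pc1 c12 e0 sep; split=> //.
- have [] := @separated_discrete_closed [set p] 1 ltr01.
    by move=> x y -> ->.
  by [].
- have [dV cV] := @separated_discrete_closed
    ((c1 @` crit c1 `|` c2 @` crit c2) `&` ~` [set p]) e e0
    (fun v w Vv Vw => sep v w Vv.1 Vw.1).
  by split=> //; exact: closed_subspaceW.
move=> q C ->{q} [z [zE zp] _]; exfalso.
have cc1 : continuous c1 by apply: continuous_smooth; case: TS1.
(* This closed set contains the region, hence its closure, and its points have first coordinate
   above [p]; the point [z] over [p] cannot exist. *)
have cF : closed [set x : R * R | 0 <= x.1 - c1 x.2].
  apply: (@preimage_closed _ _ (fun x => x.1 - c1 x.2) [set y | 0 <= y]);
    last exact: closed_ge.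
  move=> x _; apply: cvgB; first exact: cvg_fst.
  by apply: (@cvg_comp _ _ _ snd c1 _ (nbhs x.2)); [exact: cvg_snd|exact: cc1].
have : closure (region c1 c2) `<=` [set x : R * R | 0 <= x.1 - c1 x.2].
  rewrite [X in _ `<=` X](closure_id _).1//; apply: closure_subset => x.
  by move=> /andP[/ltW]; rewrite /= subr_ge0.
by move=> /(_ z zE) /=; rewrite zp subr_ge0 leNgt pc1.
Qed.

(** The argument is the second coordinate of a point of the graph, so shifting it is a vertical
    translation. *)
Lemma congruent_graph_shift c d (v : R) :
  (forall x, c x = d (x + v)) -> congruent (graph c) (graph d).
Proof.
move=> cd; exists (translation (0, v)); first exact: motion_translation.
apply/seteqP; split=> [_ [_ [x _ <-] <-]|_ [x _ <-]].
  by exists (x + v) => //; rewrite /translation /= addr0 cd.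
exists (c (x - v), x - v); first by exists (x - v).
by rewrite /translation /= addr0 cd subrK.
Qed.

Lemma not_bounded_set_ubound A : ~ has_ubound A -> ~ bounded_set A.
Proof.
move=> uA [M [_ AM]]; apply: uA; exists (M + 1) => x Ax.
by apply: le_trans (ler_norm x) _; apply: AM => //; rewrite ltrDl.
Qed.

End plane_curves.

(** * Estimates for sine and the solutions of [cos u = -1] *)

Section trigonometry.
Context {R : realType}.
Implicit Types t u v : R.

(** Up to [pi] the mean value theorem applies with [cos c < 1]; beyond [pi] already
    [sin t <= 1 < t]. *)
Lemma sin_lt t : 0 < t -> sin t < t.
Proof.
move=> t0; have [tpi|pit] := leP t pi; last first.
  rewrite (le_lt_trans (sin_le1 t))// (lt_trans _ pit)//.
  by rewrite (lt_le_trans _ (pi_ge2 R))// ltr1n.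
have [c /itvP cI] := MVT t0 (fun x _ => is_derive_sin x)
  (continuous_subspaceT (@continuous_sin R)).
rewrite sin0 !subr0 => ->; rewrite -[ltRHS]mul1r ltr_pM2r// -cos0.
rewrite ltr_cos ?cI// in_itv /= ?lexx ?pi_ge0//.
by rewrite (le_trans _ tpi) ?cI.
Qed.

(** Sine is positive before [pi], and past [pi] one has [t / 2 > 1]. The slope [1 / 2] is the one
    needed to compare [ramp] with [wave]. *)
Lemma sin_gtN2 t : 0 < t -> - (t / 2) < sin t.
Proof.
move=> t0; have [tpi|pit|->] := ltgtP t pi.
- by rewrite (lt_trans _ (sin_gt0_pi _)) ?t0// oppr_lt0 divr_gt0.
- rewrite (lt_le_trans _ (sin_geN1 t))// ltrN2.
  by have := @pi_ge2 R; lra.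
- by rewrite sinpi oppr_lt0 divr_gt0 ?pi_gt0.
Qed.

(** With midpoint [m] and half-difference [t], [sin v - sin u = 2 * cos m * sin t], which is smaller
    than [2 * t] in absolute value. Strictness thus survives the zeros of the derivative. *)
Lemma addr_sin_incr u v : u < v -> u + sin u < v + sin v.
Proof.
move=> uv; set m := (u + v) / 2; set t := (v - u) / 2.
have t0 : 0 < t by rewrite divr_gt0// subr_gt0.
have -> : u = m - t by rewrite /m /t; field.
have -> : v = m + t by rewrite /m /t; field.
rewrite sinB sinD.
have : `|cos m * sin t| < t.
  rewrite normrM (le_lt_trans (ler_piMl _ (cos_max m)))//.
  by rewrite ltr_norml sin_lt// andbT (lt_trans _ (sin_gtN2 t0))//; lra.
by rewrite ltr_norml => /andP[]; lra.
Qed.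

(** The odd multiples of [pi], which are the positive zeros of [1 + cos]. *)
Definition crest (k : nat) : R := pi + (pi *+ 2) *+ k.

Lemma crest_gt k : k%:R < crest k.
Proof.
rewrite /crest -mulr_natr; have := @pi_ge2 R; have : 0 <= k%:R :> R by [].
nra.
Qed.

Lemma crest_inj_lt1 j k : `|crest j - crest k| < 1 -> j = k.
Proof.
wlog jk : j k / (j <= k)%N => [hw|].
  have [/hw//|/ltnW kj jk] := leqP j k.
  by apply/esym/hw; rewrite // distrC.
move=> jk1; apply/eqP; rewrite eqn_leq jk /= leqNgt; apply/negP => ltjk.
move: jk1; rewrite /crest opprD addrACA subrr add0r distrC -mulrnBr//.
move=> /ltr_normlW.
have kj1 : 1 <= (k - j)%:R :> R by rewrite ler1n subn_gt0.
rewrite -mulr_natr; have := @pi_ge2 R; nra.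
Qed.

Lemma cos_eqN1 u : 0 < u -> cos u = -1 <-> exists k, u = crest k.
Proof.
move=> u0; split=> [|[k ->]]; last by rewrite (periodicn (@cosD2pi R)) cospi.
have p20 : 0 < pi *+ 2 :> R by rewrite mulrn_wgt0// pi_gt0.
(* [k] counts the full turns in [u], leaving a remainder [r] in [[0, 2 pi)]. Injectivity of cosine
   on [[0, pi]] then applies to [r] or to [2 pi - r]. *)
set k := Num.truncn (u / (pi *+ 2)).
have /andP[k1 k2] : k%:R <= u / (pi *+ 2) < k.+1%:R.
  by apply: truncn_itv; rewrite divr_ge0 ?ltW.
pose r := u - (pi *+ 2) *+ k.
have ur : u = r + (pi *+ 2) *+ k by rewrite /r subrK.
have r0 : 0 <= r.
  by rewrite subr_ge0 -mulr_natl -ler_pdivlMr.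
have r2 : r < pi *+ 2.
  by rewrite ltrBlDr -mulrS -mulr_natl -ltr_pdivrMr.
rewrite ur (periodicn (@cosD2pi R)) => cr.
exists k; rewrite /crest; congr (_ + _).
have pipi : (pi : R) \in `[0, pi]%R by rewrite in_itv /= pi_ge0 lexx.
have [rpi|pir] := leP r pi.
  by apply: cos_inj; rewrite ?cospi// in_itv /= r0.
have : pi *+ 2 - r = pi.
  apply: cos_inj => //; last by rewrite cospi addrC cosD2pi cosN.
  by rewrite in_itv /= subr_ge0 ltW//= mulr2n lerBlDr lerD2l ltW.
by rewrite mulr2n => /eqP; rewrite subr_eq => /eqP /addrI ->.
Qed.

End trigonometry.

(** * The curves [ramp] and [wave]: critical points, order, limits and ranges *)

Section exponential_curves.
Context {R : realType}.
Implicit Types p s x : R.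

Definition ramp p s x : R := p + expR (x - s).

Definition wave p s x : R := p + expR (x - s) + sin (expR (x - s)).

Lemma bounded_tower_ramp p s : bounded_tower (ramp p s).
Proof.
exact: bounded_towerD (bounded_tower_cst p)
  (bounded_tower_shift s bounded_tower_expR).
Qed.

Lemma bounded_tower_wave p s : bounded_tower (wave p s).
Proof.
exact: bounded_towerD (bounded_tower_ramp p s)
  (bounded_tower_shift s bounded_tower_sin_expR).
Qed.

Lemma is_derive_expR_shift s x :
  is_derive x 1 (fun x : R => expR (x - s)) (expR (x - s)).
Proof.
have ds : is_derive x 1 (id \- cst s : R -> R) 1.
  by apply: is_derive_eq; rewrite subr0.
by rewrite -[expR (x - s)]mulr1; exact: (@is_derive1_comp _ expR (id \- cst s)).
Qed.

Lemma crit_ramp p s : crit (ramp p s) = set0.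
Proof.
apply/seteqP; split=> // x; rewrite /crit /= => dx.
have de := is_derive_expR_shift s x.
have dr := is_deriveD (is_derive_cst p x 1) de.
have : expR (x - s) = 0.
  rewrite -[LHS]add0r -(@derive_val _ _ _ _ _ _ _ dr).
  by rewrite -(@derive_val _ _ _ _ _ _ _ dx).
by move/eqP; rewrite expR_eq0.
Qed.

Lemma is_derive_wave p s x :
  is_derive x 1 (wave p s) (expR (x - s) * (1 + cos (expR (x - s)))).
Proof.
have de := is_derive_expR_shift s x.
have dsin := @is_derive1_comp _ sin _ x _ _ (is_derive_sin _) de.
have -> : wave p s = cst p + (fun x : R => expR (x - s)) +
  (sin \o (fun x : R => expR (x - s))) by [].
by apply: is_derive_eq; rewrite add0r mulrDr mulr1 mulrC.
Qed.

Lemma crit_wave p s :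
  crit (wave p s) = range (fun k : nat => s + ln (crest k : R)).
Proof.
have cr0 k : 0 < crest k :> R by rewrite (le_lt_trans _ (crest_gt k)).
have critE x : crit (wave p s) x <-> cos (expR (x - s)) = -1.
  have dw := is_derive_wave p s x; split=> [dx|cx].
    have /eqP : expR (x - s) * (1 + cos (expR (x - s))) = 0.
      by rewrite -(@derive_val _ _ _ _ _ _ _ dw) (@derive_val _ _ _ _ _ _ _ dx).
    by rewrite mulf_eq0 expR_eq0 /= addrC addr_eq0 => /eqP.
  by rewrite /crit /=; apply: is_derive_eq; rewrite cx subrr mulr0.
apply/seteqP; split=> x.
  move=> /critE /(cos_eqN1 (expR_gt0 _)) [k ek]; exists k => //.
  by rewrite -ek expRK subrKC.
move=> [k _ <-]; apply/critE/cos_eqN1; first exact: expR_gt0.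
by exists k; rewrite addrAC subrr add0r lnK ?posrE.
Qed.

(** Sine vanishes at every crest, so the critical values do not depend on the shift [s]; two
    translates share them, and their union stays separated. *)
Lemma wave_crit p s :
  wave p s @` crit (wave p s) `<=` range (fun k => p + crest k : R).
Proof.
have cr0 k : 0 < crest k :> R by rewrite (le_lt_trans _ (crest_gt k)).
move=> _ [x + <-]; rewrite crit_wave => -[k _ <-]; exists k => //.
rewrite /wave [s + _ - s]addrAC subrr add0r lnK ?posrE//.
by rewrite {3}/crest (periodicn (@sinD2pi R)) sinpi addr0.
Qed.

Lemma countable_crit_wave p s : countable (crit (wave p s)).
Proof. by rewrite crit_wave; exact: card_le_trans (card_image_le _ _) _. Qed.

Lemma crit_wave_lbound p s : has_lbound (crit (wave p s)).
Proof.
exists s; rewrite crit_wave => _ [k _ <-]; rewrite lerDl ln_ge0//.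
rewrite /crest (@le_trans _ _ pi)//.
  by rewrite (le_trans _ (pi_ge2 R))// ler1n.
by rewrite lerDl; do 2!apply: mulrn_wge0; exact: pi_ge0.
Qed.

Lemma crit_wave_nubound p s : ~ has_ubound (crit (wave p s)).
Proof.
have cr0 k : 0 < crest k :> R by rewrite (le_lt_trans _ (crest_gt k)).
rewrite crit_wave => -[B uB].
(* This [k] exceeds [expR (B - s)], and [crest k] exceeds [k], so the critical point of index [k]
   lies beyond [B]. *)
pose k := (Num.truncn (expR (B - s))).+1.
have : s + ln (crest k : R) <= B by apply: uB; exists k.
apply/negP; rewrite -ltNge -ltrBlDl -ltr_expR lnK ?posrE//.
apply: lt_trans (crest_gt k).
by have /andP[] := truncn_itv (expR_ge0 (B - s)).
Qed.

Lemma TS_ramp p s : TS_function (ramp p s).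
Proof.
apply: TS_function_countable; last by rewrite crit_ramp.
exact: smooth_bounded_tower (bounded_tower_ramp p s).
Qed.

Lemma TS_wave p s : TS_function (wave p s).
Proof.
apply: TS_function_countable (countable_crit_wave p s).
exact: smooth_bounded_tower (bounded_tower_wave p s).
Qed.

Lemma ramp_gt p s x : p < ramp p s x.
Proof. by rewrite ltrDl expR_gt0. Qed.

Lemma wave_gt p s x : p < wave p s x.
Proof.
rewrite /wave -addrA ltrDl; have e0 := expR_gt0 (x - s).
by have := sin_gtN2 e0; lra.
Qed.

Lemma ltr_wave p s t x : t < s -> wave p s x < wave p t x.
Proof.
move=> ts; rewrite /wave -!addrA ltrD2l addr_sin_incr// ltr_expR.
by rewrite ltrD2l ltrN2.
Qed.

(** Since [expR 1 >= 2], [expR (x - 1)] is at most half of [expR x], while the sine takes away less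
    than half of it. *)
Lemma ramp_lt_wave p x : ramp p 1 x < wave p 0 x.
Proof.
rewrite /ramp /wave -addrA ltrD2l subr0 expRD expRN.
have e0 := expR_gt0 x; have := sin_gtN2 e0.
have e2 : (expR 1 : R)^-1 <= 2^-1.
  by rewrite lef_pV2 ?posrE ?expR_gt0// -[leLHS]/(1 + 1) expR_ge1Dx.
have := ler_wpM2l (ltW e0) e2; lra.
Qed.

Lemma range_above p (c : R -> R) : smooth c -> (forall x, p < c x) ->
  c x @[x --> -oo] --> p -> c x @[x --> +oo] --> +oo ->
  range c = [set y | p < y].
Proof.
move=> sc pc cp cy; apply/seteqP; split=> [_ [x _ <-] /=|y /= py].
  exact: pc.
have [a [_ ca]] : \forall x \near -oo, c x < y by exact: cvgr_lt cp _ py.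
have [b [_ cb]] : \forall x \near +oo, y < c x by move/cvgryPgt : cy; exact.
(* The limits control [c] only strictly beyond [a] and [b], hence the margins; [min] and [max] also
   put the endpoints in order. *)
pose a' := Num.min a b - 1; pose b' := Num.max a b + 1.
have ab : a' <= b'.
  have := ge_min a a b; have := le_max a a b; rewrite !lexx /=.
  by rewrite /a' /b' => h1 h2; lra.
have ya : c a' < y by apply: ca; rewrite /a' ltrBlDr ltr_pwDr// ge_min lexx.
have yb : y < c b' by apply: cb; rewrite /b' ltr_pwDr// le_max lexx orbT.
have [|x _ <-] := IVT ab (continuous_subspaceT (continuous_smooth sc)) (v := y).
  by rewrite ge_min le_max (ltW ya) (ltW yb) orbT.
by exists x.
Qed.

Lemma expR_shift_cvgNy s : expR (x - s) @[x --> -oo] --> (0 : R).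
Proof.
apply/cvgNy_compNP.
have -> : (fun x : R => expR (x - s)) \o -%R =
    (fun x => expR (- s) * expR (- x)).
  by apply/funext => x; rewrite /= addrC expRD.
by have := cvgM (cvg_cst (expR (- s))) (@cvgr_expR R); rewrite mulr0; apply.
Qed.

Lemma expR_shift_cvgy s : expR (x - s) @[x --> +oo] --> +oo.
Proof.
apply/cvgryPge => M; near=> x.
rewrite (le_trans _ (expR_ge1Dx _))// -lerBlDl lerBrDr.
by near: x; apply: nbhs_pinfty_ge; exact: num_real.
Unshelve. all: by end_near. Qed.

Lemma ramp_cvgNy p s : ramp p s x @[x --> -oo] --> p.
Proof.
by have := cvgD (cvg_cst p) (expR_shift_cvgNy s); rewrite addr0; apply.
Qed.

Lemma wave_cvgNy p s : wave p s x @[x --> -oo] --> p.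
Proof.
have sin_cvg := @cvg_comp _ _ _ (fun x : R => expR (x - s)) sin _ _ _
  (expR_shift_cvgNy s) (@continuous_sin R 0).
by have := cvgD (@ramp_cvgNy p s) sin_cvg; rewrite sin0 addr0; apply.
Qed.

Lemma ramp_cvgy p s : ramp p s x @[x --> +oo] --> +oo.
Proof.
apply/cvgryPge => M; have /cvgryPge/(_ (M - p)) := expR_shift_cvgy s.
by apply: filterS => x; rewrite lerBlDl.
Qed.

Lemma wave_cvgy p s : wave p s x @[x --> +oo] --> +oo.
Proof.
(* As sine is at least [-1], the ramp lowered by 1 is a minorant. *)
apply: ger_cvgy (ramp_cvgy (p - 1) s); near=> x.
by rewrite /ramp /wave; have := sin_geN1 (expR (x - s)); lra.
Unshelve. all: by end_near. Qed.

Lemma range_ramp p s : range (ramp p s) = [set y | p < y].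
Proof.
apply: range_above; [|exact: ramp_gt|exact: ramp_cvgNy|exact: ramp_cvgy].
exact: smooth_bounded_tower (bounded_tower_ramp p s).
Qed.

Lemma range_wave p s : range (wave p s) = [set y | p < y].
Proof.
apply: range_above; [|exact: wave_gt|exact: wave_cvgNy|exact: wave_cvgy].
exact: smooth_bounded_tower (bounded_tower_wave p s).
Qed.

Lemma crest_values_separated p (V : set R) :
  V `<=` range (fun k => p + crest k : R) ->
  forall v w, V v -> V w -> `|v - w| < 1 -> v = w.
Proof.
move=> VS v w /VS [j _ <-] /VS [k _ <-].
by rewrite opprD addrACA subrr add0r => /crest_inj_lt1 ->.
Qed.

Lemma admissible_ramp_wave p : admissible [set p] (ramp p 1) (wave p 0).
Proof.
apply: (@admissible_above _ _ _ _ 1 (TS_ramp _ _) (TS_wave _ _)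
  (ramp_gt _ _) (ramp_lt_wave _) ltr01).
apply: (crest_values_separated (p := p)).
by rewrite crit_ramp image_set0 set0U; exact: wave_crit.
Qed.

Lemma admissible_wave p s t : t < s -> admissible [set p] (wave p s) (wave p t).
Proof.
move=> ts.
apply: (@admissible_above _ _ _ _ 1 (TS_wave _ _) (TS_wave _ _)
  (wave_gt _ _) (fun x => ltr_wave p x ts) ltr01).
apply: (crest_values_separated (p := p)).
by rewrite subUset; split; exact: wave_crit.
Qed.

Lemma globally_similar_ramp_wave p : globally_similar (ramp p 1) (wave p 0).
Proof.
right; exists (ramp p 0), (wave p 0), (fun x => sin (expR (x - 0))); split=> //.
- apply: (@congruent_graph_shift _ _ _ (-1)) => x.
  by rewrite /ramp subr0.
- by apply: (@congruent_graph_shift _ _ _ 0) => x; rewrite addr0.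
- exact: smooth_bounded_tower (bounded_tower_shift 0 bounded_tower_sin_expR).
- exists 1; split=> // M M1 _ [x _ <-].
  exact: le_trans (sin_max _) (ltW M1).
Qed.

Lemma globally_similar_wave p : globally_similar (wave p 1) (wave p 0).
Proof.
left; apply: (@congruent_graph_shift _ _ _ (-1)) => x.
by rewrite /wave subr0.
Qed.

End exponential_curves.

Theorem theorem5 (R : realType) (p1 : R) :
  (exists c1 c2 : R -> R,
     [/\ real_analytic c1 /\ real_analytic c2,
         globally_similar c1 c2,
         admissible_onto_ray p1 c1 c2,
         crit_empty_unbounded c1 c2 &
         cvg_at_ninfty p1 c1 c2 /\ diverge_at_pinfty c1 c2]) /\
  (exists c1 c2 : R -> R,
     [/\ real_analytic c1 /\ real_analytic c2,
         globally_similar c1 c2,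
         admissible_onto_ray p1 c1 c2,
         cvg_at_ninfty p1 c1 c2 /\ diverge_at_pinfty c1 c2 &
         crit_unbounded c1 c2]) /\
  (exists c1 c2 : R -> R,
     [/\ real_analytic c1 /\ real_analytic c2,
         globally_similar c1 c2,
         admissible_onto_ray p1 c1 c2,
         cvg_at_ninfty p1 c1 c2 /\ diverge_at_pinfty c1 c2 &
         crit_lbounded_not_ubounded c1 c2]).
Proof.
have anaW s : real_analytic (wave p1 s).
  exact: real_analytic_bounded_tower (bounded_tower_wave p1 s).
have ray : admissible_onto_ray p1 (wave p1 1) (wave p1 0).
  by split; [exact: admissible_wave|exact: range_wave|exact: range_wave].
have lim : cvg_at_ninfty p1 (wave p1 1) (wave p1 0) /\
    diverge_at_pinfty (wave p1 1) (wave p1 0).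
  by split; split; try exact: wave_cvgNy; exact: wave_cvgy.
(* Unboundedness above already implies unboundedness, so one pair of waves serves the last two
   claims. *)
have nb s : ~ bounded_set (crit (wave p1 s)).
  exact: not_bounded_set_ubound (@crit_wave_nubound _ _ _).
split; [|split].
- exists (ramp p1 1), (wave p1 0); split.
  + by split=> //; exact: real_analytic_bounded_tower (bounded_tower_ramp p1 1).
  + exact: globally_similar_ramp_wave.
  + by split; [exact: admissible_ramp_wave|exact: range_ramp|exact: range_wave].
  + by split; first exact: crit_ramp.
  + split; split; [exact: ramp_cvgNy|exact: wave_cvgNy|exact: ramp_cvgy|].
    exact: wave_cvgy.
- exists (wave p1 1), (wave p1 0); split=> //.
  exact: globally_similar_wave.
- exists (wave p1 1), (wave p1 0); split=> //.
    exact: globally_similar_wave.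
  by split; split; [exact: crit_wave_lbound|exact: crit_wave_nubound
    |exact: crit_wave_lbound|exact: crit_wave_nubound].
Qed.
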